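(* Let $n\ge1$ and $0<\varphi<t<1$ with $nt$ an integer. Define $$\mathrm{lE}_n(t|\varphi)=\min\left((t-\varphi)\sqrt{\frac{\pi n}{8\varphi(1-\varphi)}},\,1\right),\qquad Z=Y\!\left(\sqrt{\frac{n}{\varphi(1-\varphi)}}(t-\varphi)\right).$$ Then $$-\log P_{\mathrm{X},n}(t|\varphi)\in-\log P_{\mathrm{PBR},n}(t|\varphi)+\log(n+1)-\log\left(t\sqrt{\frac{1-\varphi}{\varphi}}\right)-\log\big(\sqrt n\,Z\big)+\left[-\frac{\mathrm{lE}_n(t|\varphi)}{n(t-\varphi)},0\right],$$ $$-\log P_{\mathrm{X},n}(t|\varphi)\in-\log P_{\mathrm{CH},n}(t|\varphi)+\tfrac12\log n-\log\left(\sqrt{\frac{t(1-\varphi)}{2\pi(1-t)\varphi}}\right)-\log\big(\sqrt n\,Z\big)+\left[-\frac{\mathrm{lE}_n(t|\varphi)}{n(t-\varphi)},\frac{1}{12nt(1-t)}\right].$$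
   Context: Logarithms are natural. $Y(x)=e^{x^2/2}\int_x^\infty e^{-s^2/2}\,ds$ for $x\ge0$. For an integer $n\ge1$, $0<\varphi<1$ and $t\in[0,1]$ with $nt$ an integer: $P_{\mathrm{X},n}(t|\varphi)=\sum_{k\ge nt}\binom{n}{k}\varphi^k(1-\varphi)^{n-k}$; $P_{\mathrm{CH},n}(t|\varphi)=\left(\frac{\varphi}{t}\right)^{nt}\left(\frac{1-\varphi}{1-t}\right)^{n(1-t)}$ if $t\ge\varphi$, and $=1$ otherwise; $P_{\mathrm{PBR},n}(t|\varphi)=\varphi^{nt}(1-\varphi)^{n(1-t)}(n+1)\binom{n}{nt}$ if $t\ge\varphi$, and $=t^{nt}(1-t)^{n(1-t)}(n+1)\binom{n}{nt}$ otherwise. Interval notation: $x\in y+[u,v]$ means $y+u\le x\le y+v$. *)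

(* Defs.v *)
From Stdlib Require Import Reals Lra.
Open Scope R_scope.

Definition improper_int_to_infty (f : R -> R) (a L : R) : Prop :=
  forall eps, 0 < eps -> exists M, forall b, M <= b ->
    forall pr : Riemann_integrable f a b, Rabs (RiemannInt pr - L) < eps.

(* n-th argument n, m = n t (an integer), so t = m / n *)
Definition tt (n m : nat) : R := INR m / INR n.

Definition P_X (n m : nat) (phi : R) : R :=
  sum_f m n (fun k => Binomial.C n k * phi ^ k * (1 - phi) ^ (n - k)).

Definition P_CH (n m : nat) (phi : R) : R :=
  let t := tt n m in
  if Rle_dec phi t
  then (phi / t) ^ m * ((1 - phi) / (1 - t)) ^ (n - m)
  else 1.

Definition P_PBR (n m : nat) (phi : R) : R :=
  let t := tt n m in
  if Rle_dec phi t
  then phi ^ m * (1 - phi) ^ (n - m) * INR (n + 1) * Binomial.C n m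
  else t ^ m * (1 - t) ^ (n - m) * INR (n + 1) * Binomial.C n m.

Definition lE (n m : nat) (phi : R) : R :=
  Rmin ((tt n m - phi) * sqrt (PI * INR n / (8 * phi * (1 - phi)))) 1.

(* Main.v *)
Require Import Defs.
From Stdlib Require Import Reals Lra Lia Factorial.
From Coquelicot Require Import Coquelicot.
Open Scope R_scope.

(** Put [sigma = sqrt (n p (1 - p))], [h = / sigma], [x_k = (k - n p) / sigma], and let [b k] be
    the binomial weights.  For a function [G], put [T k = sigma * k / (n p) * b k * G (x_k)].
    Since [k / (n p) = 1 + x_k (1 - p) h] and [(n - k) / (n (1 - p)) = 1 - x_k p h], the
    difference [T k - T (k + 1)] is
    [sigma * b k * ((1 + x_k (1 - p) h) G (x_k) - (1 - x_k p h) G (x_k + h))].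
    So [T m] is a lower (upper) bound of the binomial tail as soon as the last factor is at most
    (at least) [h].  The ODE [Y' = x Y - 1] shows that it is at most [h] for [G = Y], and at least
    [h] both for [G = exp (h Y(0) / 2) Y] and for [G = (1 + h / x) Y].  For odd [n] and [p = 1/2]
    the tail from [(n + 1) / 2] is [1/2], and the lower bound together with Wallis' inequality
    gives [Y(0) <= sqrt (pi / 2)].  The second pair of bounds follows from the first by Stirling's
    formula with the remainder [r_n], which is decreasing with [0 <= r_n <= 1 / (12 n)]. *)

(** * The Mills ratio *)

Lemma le_of_derive_nonneg (f f' : R -> R) (a b : R) :
  a <= b -> (forall x, a <= x <= b -> is_derive f x (f' x)) ->
  (forall x, a <= x <= b -> 0 <= f' x) -> f a <= f b.
Proof.
  intros hab hd hp.
  destruct (MVT_gen f a b f') as [c [hc e]].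
  - rewrite Rmin_left, Rmax_right by lra. intros x hx; apply hd; lra.
  - rewrite Rmin_left, Rmax_right by lra. intros x hx.
    apply continuity_pt_filterlim, (ex_derive_continuous f).
    exists (f' x); apply hd; lra.
  - rewrite Rmin_left, Rmax_right in hc by lra.
    specialize (hp c hc); nra.
Qed.

Lemma nonneg_of_derive_nonpos_lim0 (f f' : R -> R) (a : R) :
  (forall x, a <= x -> is_derive f x (f' x)) ->
  (forall x, a <= x -> f' x <= 0) -> is_lim f p_infty 0 -> 0 <= f a.
Proof.
  intros hd hp hl.
  apply (is_lim_le_loc f (fun _ => f a) p_infty 0 (f a)); auto.
  2: apply is_lim_const.
  exists a; intros x hx.
  apply Ropp_le_cancel.
  apply (le_of_derive_nonneg (fun y => - f y) (fun y => - f' y)); try lra.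
  - intros y hy; apply (is_derive_opp f), hd; lra.
  - intros y hy; specialize (hp y); lra.
Qed.

(** For [x >= 1], [exp (x ^ 2 / 2) >= 1 + x ^ 2 / 2 >= x / 2], so the product is at most [2 * C / x]
    in absolute value. *)
Lemma lim_gauss_bounded (g : R -> R) (C : R) :
  (forall x, 1 <= x -> Rabs (g x) <= C) ->
  is_lim (fun x => exp (- x ^ 2 / 2) * g x) p_infty 0.
Proof.
  intros hg.
  assert (lim0 : is_lim (fun x => 2 * C * / x) p_infty 0).
  { replace 0 with (2 * C * 0) by ring.
    apply (is_lim_scal_l (fun x => / x) (2 * C) p_infty 0).
    apply (is_lim_inv (fun x => x) p_infty p_infty); [apply is_lim_id | easy]. }
  apply (is_lim_le_le_loc (fun x => - (2 * C * / x)) (fun x => 2 * C * / x)).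
  - exists 1; intros x hx.
    assert (hx1 : 1 <= x) by lra.
    specialize (hg x hx1).
    assert (0 < exp (- x ^ 2 / 2)) by apply exp_pos.
    assert (he : exp (- x ^ 2 / 2) <= 2 * / x).
    { replace (- x ^ 2 / 2) with (- (x ^ 2 / 2)) by field.
      rewrite exp_Ropp.
      replace (2 * / x) with (/ (x / 2)) by (field; lra).
      apply Rinv_le_contravar; [lra|].
      pose proof (exp_ineq1_le (x ^ 2 / 2)); nra. }
    apply Rabs_le_between.
    rewrite Rabs_mult, (Rabs_right (exp _)) by lra.
    pose proof (Rabs_pos (g x)); nra.
  - replace (Finite 0) with (Rbar_opp 0) by (simpl; f_equal; ring).
    now apply is_lim_opp.
  - exact lim0.
Qed.

(* Pins down [J x] as the integral of [exp (- s ^ 2 / 2)] from [x] to infinity; the tail function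
   is recovered from the one integral in the theorem, so convergence is never proved. *)
Definition gauss_tail (J : R -> R) : Prop :=
  (forall x, is_derive J x (- exp (- x ^ 2 / 2))) /\ is_lim J p_infty 0.

(** For [gauss_tail J] this is the function Y of the theorem, extended to the whole line. *)
Definition mills (J : R -> R) (x : R) : R := exp (x ^ 2 / 2) * J x.

Lemma gauss_tail_mills (J : R -> R) (x : R) : J x = exp (- x ^ 2 / 2) * mills J x.
Proof.
  unfold mills. rewrite <- Rmult_assoc, <- exp_plus.
  replace (- x ^ 2 / 2 + x ^ 2 / 2) with 0 by field. rewrite exp_0; ring.
Qed.

Lemma is_derive_mills (J : R -> R) (x : R) :
  gauss_tail J -> is_derive (mills J) x (x * mills J x - 1).
Proof.
  intros [hJ _]. unfold mills.
  assert (E : is_derive (fun y => exp (y ^ 2 / 2)) x (x * exp (x ^ 2 / 2))).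
  { auto_derive; auto. simpl; unfold Rdiv; field. }
  pose proof (is_derive_mult _ _ _ _ _ E (hJ x) Rmult_comm) as H.
  apply (is_derive_ext (fun t => mult (exp (t ^ 2 / 2)) (J t))); [easy|].
  replace (x * (exp (x ^ 2 / 2) * J x) - 1)
    with (plus (mult (x * exp (x ^ 2 / 2)) (J x)) (mult (exp (x ^ 2 / 2)) (- exp (- x ^ 2 / 2)))); auto.
  unfold plus, mult; simpl.
  assert (exp (x ^ 2 / 2) * exp (- x ^ 2 / 2) = 1).
  { rewrite <- exp_plus, <- exp_0; f_equal; field. }
  simpl in *. nra.
Qed.

(** * Comparison with sub- and supersolutions of the ODE *)

Lemma is_derive_eq (f : R -> R) (x l l' : R) : is_derive f x l -> l = l' -> is_derive f x l'.
Proof. now intros H <-. Qed.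

(** By [gauss_tail_mills] the function is [exp (- y ^ 2 / 2) * (W y - mills J y)]. The Gaussian is
    an integrating factor, so only the defect [w - x * W x + 1] of [W] in the ODE of [mills J]
    remains. *)
Lemma is_derive_gauss_gap (J W : R -> R) (x w : R) :
  gauss_tail J -> is_derive W x w ->
  is_derive (fun y => exp (- y ^ 2 / 2) * W y - J y) x
    (exp (- x ^ 2 / 2) * (w - x * W x + 1)).
Proof.
  intros hJ hW.
  assert (E : is_derive (fun y => exp (- y ^ 2 / 2)) x (- x * exp (- x ^ 2 / 2))).
  { auto_derive; auto. simpl; unfold Rdiv; field. }
  pose proof (is_derive_mult _ _ _ _ _ E hW Rmult_comm) as H.
  eapply is_derive_eq.
  - apply (is_derive_minus _ _ _ _ _ H (proj1 hJ x)).
  - unfold plus, mult, minus, opp, plus; simpl; ring.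
Qed.

Lemma mills_le_of_gap (J W : R -> R) (a : R) :
  0 <= exp (- a ^ 2 / 2) * W a - J a -> mills J a <= W a.
Proof.
  rewrite (gauss_tail_mills J a). intros H.
  pose proof (exp_pos (- a ^ 2 / 2)).
  apply Rmult_le_reg_l with (exp (- a ^ 2 / 2)); lra.
Qed.

Lemma lim_gauss_gap (J W : R -> R) (C : R) :
  gauss_tail J -> (forall x, 1 <= x -> Rabs (W x) <= C) ->
  is_lim (fun y => exp (- y ^ 2 / 2) * W y - J y) p_infty 0.
Proof.
  intros hJ hC.
  replace (Finite 0) with (Finite (0 - 0)) by (f_equal; ring).
  apply is_lim_minus'; [now apply lim_gauss_bounded with C | apply hJ].
Qed.

(** A nonpositive defect makes the gap [exp (- x ^ 2 / 2) * W x - J x] nonincreasing; it tends to 0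
    at infinity, so it is nonnegative at [a]. *)
Lemma mills_le_of_supersolution (J W W' : R -> R) (a C : R) :
  gauss_tail J -> (forall x, a <= x -> is_derive W x (W' x)) ->
  (forall x, 1 <= x -> Rabs (W x) <= C) ->
  (forall x, a <= x -> W' x - x * W x + 1 <= 0) -> mills J a <= W a.
Proof.
  intros hJ hW hC hs.
  apply mills_le_of_gap.
  apply (nonneg_of_derive_nonpos_lim0 (fun x => exp (- x ^ 2 / 2) * W x - J x)
      (fun x => exp (- x ^ 2 / 2) * (W' x - x * W x + 1))).
  - intros x hx. now apply is_derive_gauss_gap; auto.
  - intros x hx. specialize (hs x hx). pose proof (exp_pos (- x ^ 2 / 2)). nra.
  - now apply lim_gauss_gap with C.
Qed.

Lemma mills_ge_of_subsolution (J W W' : R -> R) (a C : R) :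
  gauss_tail J -> (forall x, a <= x -> is_derive W x (W' x)) ->
  (forall x, 1 <= x -> Rabs (W x) <= C) ->
  (forall x, a <= x -> 0 <= W' x - x * W x + 1) -> W a <= mills J a.
Proof.
  intros hJ hW hC hs.
  assert (0 <= - (exp (- a ^ 2 / 2) * W a - J a)).
  { apply (nonneg_of_derive_nonpos_lim0 (fun x => - (exp (- x ^ 2 / 2) * W x - J x))
      (fun x => - (exp (- x ^ 2 / 2) * (W' x - x * W x + 1)))).
    - intros x hx. now apply (is_derive_opp (fun x => exp (- x ^ 2 / 2) * W x - J x)), is_derive_gauss_gap; auto.
    - intros x hx. specialize (hs x hx). pose proof (exp_pos (- x ^ 2 / 2)). nra.
    - replace (Finite 0) with (Rbar_opp 0) by (simpl; f_equal; ring).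
      apply is_lim_opp. now apply lim_gauss_gap with C. }
  rewrite (gauss_tail_mills J a) in H.
  pose proof (exp_pos (- a ^ 2 / 2)).
  apply Rmult_le_reg_l with (exp (- a ^ 2 / 2)); lra.
Qed.

(** The function [/ y] is a supersolution, with defect [- / y ^ 2]. *)
Lemma mills_le_inv (J : R -> R) (x : R) : gauss_tail J -> 0 < x -> x * mills J x <= 1.
Proof.
  intros hJ hx.
  assert (H : mills J x <= / x).
  { apply (mills_le_of_supersolution J (fun y => / y) (fun y => - / y ^ 2) x 1); auto.
    - intros y hy. auto_derive; [lra | simpl; field; lra].
    - intros y hy. rewrite Rabs_right; [|left; apply Rinv_0_lt_compat; lra].
      rewrite <- Rinv_1; apply Rinv_le_contravar; lra.
    - intros y hy. rewrite Rinv_r by lra.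
      assert (0 < / y ^ 2) by (apply Rinv_0_lt_compat; nra). lra. }
  apply Rmult_le_compat_l with (r := x) in H; [|lra].
  now rewrite Rinv_r in H by lra.
Qed.

(** The function [y / (1 + y ^ 2)] is a subsolution, with defect [2 / (1 + y ^ 2) ^ 2]. *)
Lemma mills_ge (J : R -> R) (x : R) :
  gauss_tail J -> 0 <= x -> x <= (1 + x ^ 2) * mills J x.
Proof.
  intros hJ hx.
  assert (H : x / (1 + x ^ 2) <= mills J x).
  { apply (mills_ge_of_subsolution J (fun y => y / (1 + y ^ 2))
      (fun y => (1 - y ^ 2) / (1 + y ^ 2) ^ 2) x 1); auto.
    - intros y hy. auto_derive; [nra | simpl; field; nra].
    - intros y hy.
      assert (0 < 1 + y ^ 2) by nra.
      rewrite Rabs_right.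
      + apply Rmult_le_reg_r with (1 + y ^ 2); auto.
        unfold Rdiv; rewrite Rmult_assoc, Rinv_l; nra.
      + apply Rle_ge, Rdiv_le_0_compat; lra.
    - intros y hy.
      replace ((1 - y ^ 2) / (1 + y ^ 2) ^ 2 - y * (y / (1 + y ^ 2)) + 1)
        with (2 / (1 + y ^ 2) ^ 2) by (field; nra).
      apply Rdiv_le_0_compat; [lra|]. apply pow_lt; nra. }
  apply Rmult_le_compat_l with (r := 1 + x ^ 2) in H; [|nra].
  unfold Rdiv in H; rewrite <- Rmult_assoc in H.
  rewrite Rinv_r_simpl_m in H by nra. lra.
Qed.

Lemma mills_nonneg (J : R -> R) (x : R) : gauss_tail J -> 0 <= x -> 0 <= mills J x.
Proof. intros hJ hx. pose proof (mills_ge J x hJ hx). nra. Qed.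

Lemma mills_pos (J : R -> R) (x : R) : gauss_tail J -> 0 < x -> 0 < mills J x.
Proof. intros hJ hx. pose proof (mills_ge J x hJ ltac:(lra)). nra. Qed.

Lemma mills_antimono (J : R -> R) (x y : R) :
  gauss_tail J -> 0 <= x <= y -> mills J y <= mills J x.
Proof.
  intros hJ [hx hy]. apply Ropp_le_cancel.
  apply (le_of_derive_nonneg (fun y => - mills J y) (fun y => - (y * mills J y - 1))); auto.
  - intros z hz. now apply (is_derive_opp (mills J)), is_derive_mills.
  - intros z hz. destruct (Req_dec z 0) as [->|hz0]; [lra|].
    pose proof (mills_le_inv J z hJ ltac:(lra)). lra.
Qed.

Lemma is_derive_id_mul_mills (J : R -> R) (x : R) : gauss_tail J ->
  is_derive (fun y => y * mills J y) x ((1 + x ^ 2) * mills J x - x).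
Proof.
  intros hJ. eapply is_derive_eq.
  - apply (is_derive_mult (fun y => y) (mills J) x 1 _ (is_derive_id x)
      (is_derive_mills J x hJ) Rmult_comm).
  - unfold plus, mult; simpl; ring.
Qed.

(** Since [x * mills J x - 1] is the derivative of [mills J], this is the convexity of the Mills
    ratio on the half-line. *)
Lemma id_mul_mills_mono (J : R -> R) (x y : R) :
  gauss_tail J -> 0 <= x <= y -> x * mills J x <= y * mills J y.
Proof.
  intros hJ [hx hy].
  apply (le_of_derive_nonneg (fun y => y * mills J y)
    (fun y => (1 + y ^ 2) * mills J y - y)); auto.
  - intros z hz. now apply is_derive_id_mul_mills.
  - intros z hz. pose proof (mills_ge J z hJ ltac:(lra)). lra.
Qed.

(** * One-step inequalities for the Mills ratio *)

Lemma is_derive_mills_shift (J : R -> R) (x h : R) : gauss_tail J ->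
  is_derive (fun s => mills J (x + s)) h ((x + h) * mills J (x + h) - 1).
Proof.
  intros hJ. eapply is_derive_eq.
  - apply (is_derive_comp (mills J) (fun s => x + s) h _ 1 (is_derive_mills J (x + h) hJ)).
    auto_derive; auto.
  - unfold scal; simpl; unfold mult; simpl; ring.
Qed.

(** With [s] in place of [h], the difference [F s] of the two sides vanishes at [s = 0], so it is
    enough that [F] is nondecreasing. *)
Lemma mills_step_le (J : R -> R) (p q x h : R) : gauss_tail J ->
  0 <= p -> 0 <= q -> p + q = 1 -> 0 <= x -> 0 <= h ->
  (1 + x * q * h) * mills J x - (1 - x * p * h) * mills J (x + h) <= h.
Proof.
  intros hJ hp hq hpq hx hh.
  pose (F := fun s => s - (1 + x * q * s) * mills J x + (1 - x * p * s) * mills J (x + s)).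
  assert (H : F 0 <= F h).
  { apply (le_of_derive_nonneg F (fun s =>
      1 - x * q * mills J x - x * p * mills J (x + s)
      + (1 - x * p * s) * ((x + s) * mills J (x + s) - 1))); auto.
    - intros s hs. eapply is_derive_eq.
      + apply (is_derive_plus (fun s => s - (1 + x * q * s) * mills J x)
          (fun s => (1 - x * p * s) * mills J (x + s)) s
          (1 - x * q * mills J x)).
        * auto_derive; auto; ring.
        * apply (is_derive_mult (fun s => 1 - x * p * s) (fun s => mills J (x + s)) s
            (- (x * p))); [auto_derive; auto; ring | | exact Rmult_comm].
          now apply is_derive_mills_shift.
      + unfold plus, mult; simpl; ring.
    - intros s hs.
      pose proof (id_mul_mills_mono J x (x + s) hJ ltac:(lra)).
      pose proof (mills_nonneg J (x + s) hJ ltac:(lra)).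
      assert ((x + s) * mills J (x + s) <= 1).
      { destruct (Req_dec (x + s) 0) as [->|]; [lra|]. apply mills_le_inv; auto; lra. }
      (* With [q] eliminated the derivative splits into nonnegative terms: convexity handles the
         factor of [1 - p], while [0 <= mills J y] and [y * mills J y <= 1] at [y = x + s] handle
         the factor of [p * s]. *)
      replace q with (1 - p) by lra.
      replace (1 - x * (1 - p) * mills J x - x * p * mills J (x + s)
        + (1 - x * p * s) * ((x + s) * mills J (x + s) - 1))
      with ((1 - p) * ((x + s) * mills J (x + s) - x * mills J x)
        + p * s * (mills J (x + s) + x * (1 - (x + s) * mills J (x + s)))) by ring.
      assert (0 <= p * s) by nra.
      assert (0 <= x * (1 - (x + s) * mills J (x + s))) by nra.
      assert (0 <= (1 - p) * ((x + s) * mills J (x + s) - x * mills J x)) by nra.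
      nra. }
  unfold F in H. rewrite Rplus_0_r in H. lra.
Qed.

(** By convexity the graph lies above its tangent at [x + h], whose slope is [d]. *)
Lemma mills_tangent (J : R -> R) (x h : R) : gauss_tail J -> 0 <= x -> 0 <= h ->
  mills J (x + h) - h * ((x + h) * mills J (x + h) - 1) <= mills J x.
Proof.
  intros hJ hx hh.
  pose (d := (x + h) * mills J (x + h) - 1).
  assert (H : (x + h) * d - mills J (x + h) >= x * d - mills J x).
  { apply Rle_ge, (le_of_derive_nonneg (fun s => s * d - mills J s)
      (fun s => d - (s * mills J s - 1))); [lra | |].
    - intros s hs. apply (is_derive_minus (fun s => s * d) (mills J)).
      + auto_derive; auto; ring.
      + now apply is_derive_mills.
    - intros s hs. unfold d.
      pose proof (id_mul_mills_mono J s (x + h) hJ ltac:(lra)). lra. }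
  fold d; lra.
Qed.

(** The right-hand side is nondecreasing in [x]: its derivative at [s] is [s] times the gap in
    [mills_tangent]. *)
Lemma mills_increment_mono (J : R -> R) (x h : R) : gauss_tail J -> 0 <= x -> 0 <= h ->
  mills J 0 - mills J h <= mills J x - (1 - x * h) * mills J (x + h).
Proof.
  intros hJ hx hh.
  pose (F := fun s => mills J s - (1 - s * h) * mills J (s + h)).
  assert (H : F 0 <= F x).
  { apply (le_of_derive_nonneg F (fun s =>
      s * (mills J s - mills J (s + h) + h * ((s + h) * mills J (s + h) - 1)))); auto.
    - intros s hs. eapply is_derive_eq.
      + apply (is_derive_minus (mills J) (fun s => (1 - s * h) * mills J (s + h)) s).
        * now apply is_derive_mills.
        * apply (is_derive_mult (fun s => 1 - s * h) (fun s => mills J (s + h)) s (- h));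
            [auto_derive; auto; ring | | exact Rmult_comm].
          apply (is_derive_ext (fun s => mills J (h + s))); [intros; f_equal; ring|].
          now apply is_derive_mills_shift.
      + unfold minus, plus, opp, mult; simpl. rewrite (Rplus_comm h s). ring.
    - intros s hs. pose proof (mills_tangent J s h hJ ltac:(lra) hh). nra. }
  unfold F in H. rewrite Rplus_0_l in H. lra.
Qed.

(** The expression and its first derivative vanish at 0, and its second derivative
    [exp s * (2 * s ^ 2 + 5 * s)] is nonnegative. *)
Lemma exp_quadratic_bound (s : R) : 0 <= s ->
  0 <= exp s * (2 * s ^ 2 - 3 * s + 2) + s - 2.
Proof.
  intros hs.
  assert (D2 : forall s, 0 <= s -> 0 <= exp s * (2 * s ^ 2 + s - 1) + 1).
  { intros u hu.
    replace 0 with (exp 0 * (2 * 0 ^ 2 + 0 - 1) + 1) by (rewrite exp_0; ring).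
    apply (le_of_derive_nonneg (fun s => exp s * (2 * s ^ 2 + s - 1) + 1)
      (fun s => exp s * (2 * s ^ 2 + 5 * s))); auto.
    - intros x hx. auto_derive; auto; simpl; ring.
    - intros x hx. pose proof (exp_pos x). nra. }
  replace 0 with (exp 0 * (2 * 0 ^ 2 - 3 * 0 + 2) + 0 - 2) by (rewrite exp_0; ring).
  apply (le_of_derive_nonneg (fun s => exp s * (2 * s ^ 2 - 3 * s + 2) + s - 2)
      (fun s => exp s * (2 * s ^ 2 + s - 1) + 1)); auto.
  - intros x hx. auto_derive; auto; simpl; ring.
  - intros x hx. apply D2; lra.
Qed.

(** The derivative at [x] is the quantity of [exp_quadratic_bound] at [c * x], divided by [x ^ 3].
    The ratio decides the sign of the defect in [mills_increment_zero]. *)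
Lemma exp_remainder_ratio_mono (c a b : R) : 0 <= c -> 0 < a <= b ->
  ((2 * (c * a) - 1) * exp (c * a) + 1 - c * a) / a ^ 2
  <= ((2 * (c * b) - 1) * exp (c * b) + 1 - c * b) / b ^ 2.
Proof.
  intros hc [ha hab].
  apply (le_of_derive_nonneg (fun x => ((2 * (c * x) - 1) * exp (c * x) + 1 - c * x) / x ^ 2)
    (fun x => (exp (c * x) * (2 * (c * x) ^ 2 - 3 * (c * x) + 2) + c * x - 2) / x ^ 3)); auto.
  - intros x hx. auto_derive; [nra | simpl; field; lra].
  - intros x hx. apply Rdiv_le_0_compat; [apply exp_quadratic_bound; nra | apply pow_lt; lra].
Qed.

Lemma mills_zero_pos (J : R -> R) : gauss_tail J -> 0 < mills J 0.
Proof.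
  intros hJ. pose proof (mills_pos J 1 hJ ltac:(lra)).
  pose proof (mills_antimono J 0 1 hJ ltac:(lra)). lra.
Qed.

(* The defect of the comparison function [W] in the ODE changes sign once, from [+] to [-]: before
   the change compare from [0], where [W] and [mills J] agree, after it from infinity. *)
Lemma mills_increment_zero (J : R -> R) (h : R) : gauss_tail J -> 0 <= h ->
  h * exp (- (mills J 0 / 2 * h)) <= mills J 0 - mills J h.
Proof.
  intros hJ hh.
  pose proof (mills_zero_pos J hJ) as hY.
  pose (c := mills J 0 / 2). assert (hc : 0 < c) by (unfold c; lra).
  assert (hY0 : mills J 0 = 2 * c) by (unfold c; field).
  fold c. rewrite hY0.
  (* The claim reads [mills J h <= W h], and [W 0 = mills J 0]. *)
  pose (W := fun x => 2 * c - x * exp (- (c * x))).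
  pose (W' := fun x => - (1 - c * x) * exp (- (c * x))).
  assert (hW : forall x, is_derive W x (W' x)).
  { intros x. unfold W, W'. auto_derive; auto; ring. }
  (* The defect is nonnegative where [rho <= 1] and nonpositive where [rho >= 1]; as [rho] is
     nondecreasing, its value at [h] selects the side to compare from. *)
  pose (rho := fun x => ((2 * (c * x) - 1) * exp (c * x) + 1 - c * x) / x ^ 2).
  assert (hr : forall x, 0 < x ->
    W' x - x * W x + 1 = x ^ 2 * exp (- (c * x)) * (1 - rho x)).
  { intros x hx. unfold W, W', rho.
    replace (exp (c * x)) with (/ exp (- (c * x))) by (rewrite exp_Ropp; field; apply Rgt_not_eq, exp_pos).
    field. split; [apply Rgt_not_eq, exp_pos | lra]. }
  assert (hsign : forall x, 0 < x -> 0 < x ^ 2 * exp (- (c * x))).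
  { intros x hx. apply Rmult_lt_0_compat; [now apply pow_lt | apply exp_pos]. }
  cut (mills J h <= W h); [unfold W; lra|].
  destruct hh as [hh | <-]; [|unfold W; lra].
  destruct (Rle_dec 1 (rho h)) as [hl | hl].
  - apply (mills_le_of_supersolution J W W' h (2 * c + / c)); auto.
    + intros x hx. unfold W.
      assert (he : exp (- (c * x)) <= / (c * x)).
      { rewrite exp_Ropp. apply Rinv_le_contravar; [apply Rmult_lt_0_compat; lra|].
        pose proof (exp_ineq1_le (c * x)); lra. }
      pose proof (exp_pos (- (c * x))).
      assert (x * exp (- (c * x)) <= / c).
      { replace (/ c) with (x * / (c * x)) by (field; lra). nra. }
      assert (0 <= x * exp (- (c * x))) by nra.
      assert (0 < / c) by (apply Rinv_0_lt_compat; lra).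
      apply Rabs_le_between; lra.
    + intros x hx. rewrite hr by lra.
      pose proof (exp_remainder_ratio_mono c h x ltac:(lra) ltac:(lra)) as hm.
      fold (rho h) (rho x) in hm. pose proof (hsign x ltac:(lra)). nra.
  - apply mills_le_of_gap.
    replace 0 with (exp (- 0 ^ 2 / 2) * W 0 - J 0) at 1.
    2: { rewrite (gauss_tail_mills J 0), hY0. unfold W.
         ring. }
    apply (le_of_derive_nonneg (fun x => exp (- x ^ 2 / 2) * W x - J x)
      (fun x => exp (- x ^ 2 / 2) * (W' x - x * W x + 1))); [lra | |].
    + intros x _. now apply is_derive_gauss_gap.
    + intros x [[hx | <-] hxh].
      * rewrite hr by lra.
        pose proof (exp_remainder_ratio_mono c x h ltac:(lra) ltac:(lra)) as hm.
        fold (rho h) (rho x) in hm. pose proof (hsign x ltac:(lra)).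
        apply Rmult_le_pos; [left; apply exp_pos | nra].
      * unfold W', W. rewrite Rmult_0_r, Ropp_0, exp_0. lra.
Qed.

(* The right-hand side is smallest for [q = 0] and, with [q = 0], for [x = 0]. *)
Lemma mills_step_ge_exp (J : R -> R) (p q x h : R) : gauss_tail J ->
  0 <= p -> 0 <= q -> p + q = 1 -> 0 <= x -> 0 <= h ->
  h * exp (- (mills J 0 / 2 * h))
  <= (1 + x * q * h) * mills J x - (1 - x * p * h) * mills J (x + h).
Proof.
  intros hJ hp hq hpq hx hh.
  pose proof (mills_increment_zero J h hJ hh).
  pose proof (mills_increment_mono J x h hJ hx hh).
  pose proof (mills_antimono J x (x + h) hJ ltac:(lra)).
  replace p with (1 - q) by lra.
  assert (0 <= x * q * h) by (apply Rmult_le_pos; [apply Rmult_le_pos|]; auto).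
  nra.
Qed.

(** The difference [F] of the two sides vanishes at step 0 and has derivative [s * (Q 0 - Q s)].
    Here [Q] is nonincreasing, because [mills J] decreases, its derivative increases and
    [0 <= x]. *)
Lemma mills_increment_quadratic (J : R -> R) (x h : R) : gauss_tail J -> 0 <= x -> 0 <= h ->
  h - h ^ 2 / 2 * (mills J x - x * (x * mills J x - 1))
  <= mills J x - (1 - x * h) * mills J (x + h).
Proof.
  intros hJ hx hh.
  pose (Q := fun s => mills J (x + s) - x * ((x + s) * mills J (x + s) - 1)).
  pose (F := fun s => s ^ 2 / 2 * Q 0 - s + mills J x - (1 - x * s) * mills J (x + s)).
  assert (H : F 0 <= F h).
  { apply (le_of_derive_nonneg F (fun s => s * (Q 0 - Q s))); auto.
    - intros s hs. eapply is_derive_eq.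
      + apply (is_derive_minus (fun s => s ^ 2 / 2 * Q 0 - s + mills J x)
          (fun s => (1 - x * s) * mills J (x + s)) s (s * Q 0 - 1)).
        * auto_derive; auto; simpl; field.
        * apply (is_derive_mult (fun s => 1 - x * s) (fun s => mills J (x + s)) s
            (- x)); [auto_derive; auto; ring | | exact Rmult_comm].
          now apply is_derive_mills_shift.
      + unfold minus, plus, opp, mult, Q; simpl; ring.
    - intros s hs. unfold Q. rewrite Rplus_0_r.
      pose proof (id_mul_mills_mono J x (x + s) hJ ltac:(lra)).
      pose proof (mills_antimono J x (x + s) hJ ltac:(lra)).
      apply Rmult_le_pos; nra. }
  unfold F, Q in H. rewrite Rplus_0_r in H. lra.
Qed.

(** Write [G y = mills J y * (1 + h / y)]; both cases rest on [G (x + h) <= G x]. For small [x * h]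
    the term [h / y] makes up for the second-order loss in [mills_increment_quadratic]; for large
    [x * h] the bound [mills_ge] is enough. *)
Lemma mills_step_ge_inv (J : R -> R) (p q x h : R) : gauss_tail J ->
  0 <= p -> 0 <= q -> p + q = 1 -> 0 < x -> 0 <= h -> x * p * h <= 1 ->
  h <= (1 + x * q * h) * (mills J x * (1 + h / x))
       - (1 - x * p * h) * (mills J (x + h) * (1 + h / (x + h))).
Proof.
  intros hJ hp hq hpq hx hh hph.
  pose proof (mills_ge J x hJ ltac:(lra)) as hge.
  pose proof (mills_nonneg J x hJ ltac:(lra)) as hY.
  pose proof (mills_nonneg J (x + h) hJ ltac:(lra)) as hYh.
  pose proof (mills_antimono J x (x + h) hJ ltac:(lra)) as hanti.
  assert (hinv : 0 < / (x + h) <= / x).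
  { split; [apply Rinv_0_lt_compat; lra | apply Rinv_le_contravar; lra]. }
  assert (hG : mills J (x + h) * (1 + h / (x + h)) <= mills J x * (1 + h / x)).
  { apply Rmult_le_compat; auto; unfold Rdiv; nra. }
  assert (hxqh : 0 <= x * q * h) by (apply Rmult_le_pos; [apply Rmult_le_pos|]; lra).
  destruct (Rle_dec (x * h) 1) as [hs | hs].
  (* The right-hand side is smallest for [q = 0]. There the quadratic bound loses [h ^ 2 / 2 * ((1 -
     x ^ 2) * mills J x + x)] and [h4] regains [h ^ 2 * mills J x]; the balance is nonnegative by
     [mills_ge]. *)
  - apply Rle_trans with
      (mills J x * (1 + h / x) - (1 - x * h) * (mills J (x + h) * (1 + h / (x + h)))).
    2: { replace p with (1 - q) by lra.
         pose proof (Rmult_le_compat_l _ _ _ hxqh hG). lra. }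
    pose proof (mills_increment_quadratic J x h hJ ltac:(lra) hh) as hquad.
    assert (h1 : (1 - x * h) * (mills J (x + h) * / (x + h)) <= (1 - x * h) * (mills J x * / (x + h))).
    { apply Rmult_le_compat_l; [lra|]. apply Rmult_le_compat_r; lra. }
    assert (h2 : mills J x * / x - (1 - x * h) * (mills J x * / (x + h))
      = h * (mills J x * ((1 + x ^ 2) / (x * (x + h))))) by (field; lra).
    (* This is where [x * h <= 1] enters. *)
    assert (h3 : 1 <= (1 + x ^ 2) / (x * (x + h))).
    { apply Rmult_le_reg_r with (x * (x + h)); [nra|].
      unfold Rdiv; rewrite Rmult_assoc, Rinv_l; nra. }
    assert (h4 : h * mills J x <= mills J x * / x - (1 - x * h) * (mills J (x + h) * / (x + h))).
    { pose proof (Rmult_le_compat_l (h * mills J x) _ _ ltac:(nra) h3). lra. }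
    unfold Rdiv.
    apply (Rmult_le_compat_l h) in h4; [|exact hh].
    assert (0 <= h ^ 2 / 2 * ((1 + x ^ 2) * mills J x - x)) by (apply Rmult_le_pos; nra).
    nra.
  (* As [1 - x * p * h >= 0], replacing [G (x + h)] by [G x] leaves
     [x * h * G x = h * ((x + h) * mills J x)], and [mills_ge] with [x * h > 1] gives
     [(x + h) * mills J x >= 1]. *)
  - apply Rle_trans with (x * h * (mills J x * (1 + h / x))).
    2: { replace q with (1 - p) by lra.
         pose proof (Rmult_le_compat_l (1 - x * p * h) _ _ ltac:(lra) hG). lra. }
    replace (x * h * (mills J x * (1 + h / x))) with (h * ((x + h) * mills J x)) by (field; lra).
    assert (x * 1 <= x * ((x + h) * mills J x)) by nra.
    assert (1 <= (x + h) * mills J x) by nra.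
    nra.
Qed.

(** * Telescoping the binomial tail *)

(** [U] has to agree with the shift of [T] only below [n], so that the boundary term is [U n] and
    not [T (S n)]. *)
Lemma sum_f_le_telescope (f T U : nat -> R) (m n : nat) : (m <= n)%nat ->
  (forall k, (m <= k <= n)%nat -> f k <= T k - U k) ->
  (forall k, (m <= k < n)%nat -> U k = T (S k)) -> sum_f m n f <= T m - U n.
Proof.
  intros hmn. induction hmn as [|n hmn IH]; intros hf hU.
  - unfold sum_f. rewrite Nat.sub_diag. simpl. apply hf; lia.
  - rewrite sum_f_n_Sm by exact hmn.
    assert (sum_f m n f <= T m - U n).
    { apply IH; intros; [apply hf | apply hU]; lia. }
    specialize (hf (S n) ltac:(lia)). rewrite <- (hU n) in hf by lia. lra.
Qed.

Lemma sum_f_ge_telescope (f T U : nat -> R) (m n : nat) : (m <= n)%nat ->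
  (forall k, (m <= k <= n)%nat -> T k - U k <= f k) ->
  (forall k, (m <= k < n)%nat -> U k = T (S k)) -> T m - U n <= sum_f m n f.
Proof.
  intros hmn. induction hmn as [|n hmn IH]; intros hf hU.
  - unfold sum_f. rewrite Nat.sub_diag. simpl. apply hf; lia.
  - rewrite sum_f_n_Sm by exact hmn.
    assert (T m - U n <= sum_f m n f).
    { apply IH; intros; [apply hf | apply hU]; lia. }
    specialize (hf (S n) ltac:(lia)). rewrite <- (hU n) in hf by lia. lra.
Qed.

(** * Binomial weights and the telescoping sequence *)

Lemma C_pos (n k : nat) : 0 < Binomial.C n k.
Proof.
  unfold Binomial.C. apply Rdiv_lt_0_compat; [|apply Rmult_lt_0_compat]; apply INR_fact_lt_0.
Qed.

Lemma C_succ_mul (n k : nat) : (k < n)%nat ->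
  Binomial.C n (S k) * (INR k + 1) = Binomial.C n k * (INR n - INR k).
Proof.
  intros hk. unfold Binomial.C.
  replace (n - k)%nat with (S (n - S k)) by lia.
  rewrite <- minus_INR by lia. replace (n - k)%nat with (S (n - S k)) by lia.
  rewrite !fact_simpl, !mult_INR, (S_INR k).
  pose proof (INR_fact_neq_0 k). pose proof (INR_fact_neq_0 (n - S k)).
  pose proof (pos_INR k). pose proof (lt_0_INR (S (n - S k)) ltac:(lia)).
  field. repeat split; lra.
Qed.

Definition binom_term (n : nat) (p : R) (k : nat) : R :=
  Binomial.C n k * p ^ k * (1 - p) ^ (n - k).

Lemma binom_term_pos (n k : nat) (p : R) : 0 < p < 1 -> 0 < binom_term n p k.
Proof.
  intros hp. unfold binom_term.
  pose proof (C_pos n k). pose proof (pow_lt p k ltac:(lra)).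
  pose proof (pow_lt (1 - p) (n - k) ltac:(lra)).
  apply Rmult_lt_0_compat; [apply Rmult_lt_0_compat|]; assumption.
Qed.

(** Both sides are the weight of [k] successes in [n - 1] trials. *)
Lemma binom_term_succ (n k : nat) (p : R) : 0 < p < 1 -> (k < n)%nat ->
  binom_term n p (S k) * ((INR k + 1) / (INR n * p))
  = binom_term n p k * ((INR n - INR k) / (INR n * (1 - p))).
Proof.
  intros hp hk. unfold binom_term.
  pose proof (lt_0_INR n ltac:(lia)).
  replace (n - k)%nat with (S (n - S k)) by lia. simpl pow.
  transitivity (Binomial.C n (S k) * (INR k + 1) * (p ^ k * (1 - p) ^ (n - S k)) / INR n).
  - field; lra.
  - rewrite C_succ_mul by exact hk. field; lra.
Qed.

Definition binom_sd (n : nat) (p : R) : R := sqrt (INR n * p * (1 - p)).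

Definition binom_std (n : nat) (p : R) (k : nat) : R := (INR k - INR n * p) / binom_sd n p.

(* The factor in front of [G] is [sigma * b(k-1; n-1, p)], where [b] is the binomial weight. *)
Definition tail_approx (n : nat) (p : R) (G : R -> R) (k : nat) : R :=
  binom_sd n p * binom_term n p k * (INR k / (INR n * p)) * G (binom_std n p k).

(** For [k < n] this is [tail_approx n p G (S k)]. The separate form is needed at [k = n]: it
    vanishes there, whereas truncated subtraction makes [Binomial.C n (S n)] nonzero. *)
Definition tail_approx_next (n : nat) (p : R) (G : R -> R) (k : nat) : R :=
  binom_sd n p * binom_term n p k * ((INR n - INR k) / (INR n * (1 - p)))
  * G (binom_std n p k + / binom_sd n p).

Lemma binom_sd_pos (n : nat) (p : R) : (1 <= n)%nat -> 0 < p < 1 -> 0 < binom_sd n p.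
Proof.
  intros hn hp. pose proof (lt_0_INR n ltac:(lia)).
  apply sqrt_lt_R0. repeat apply Rmult_lt_0_compat; lra.
Qed.

Lemma binom_sd_sqr (n : nat) (p : R) : 0 < p < 1 ->
  binom_sd n p * binom_sd n p = INR n * p * (1 - p).
Proof.
  intros hp. pose proof (pos_INR n).
  apply sqrt_sqrt. apply Rmult_le_pos; [apply Rmult_le_pos|]; lra.
Qed.

Lemma tail_approx_next_eq (n k : nat) (p : R) (G : R -> R) : 0 < p < 1 -> (k < n)%nat ->
  tail_approx_next n p G k = tail_approx n p G (S k).
Proof.
  intros hp hk. unfold tail_approx, tail_approx_next.
  pose proof (binom_sd_pos n p ltac:(lia) hp).
  pose proof (binom_term_succ n k p hp hk) as e.
  rewrite S_INR.
  replace (binom_std n p (S k)) with (binom_std n p k + / binom_sd n p)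
    by (unfold binom_std; rewrite S_INR; field; lra).
  rewrite Rmult_assoc with (r1 := binom_sd n p), <- e. ring.
Qed.

Lemma tail_approx_next_last (n : nat) (p : R) (G : R -> R) : tail_approx_next n p G n = 0.
Proof. unfold tail_approx_next, Rdiv. ring. Qed.

Lemma tail_approx_sub (n k : nat) (p : R) (G : R -> R) : (1 <= n)%nat -> 0 < p < 1 ->
  let h := / binom_sd n p in let x := binom_std n p k in
  tail_approx n p G k - tail_approx_next n p G k
  = binom_sd n p * binom_term n p k
    * ((1 + x * (1 - p) * h) * G x - (1 - x * p * h) * G (x + h)).
Proof.
  intros hn hp h x. unfold tail_approx, tail_approx_next. fold x h.
  pose proof (binom_sd_pos n p hn hp). pose proof (binom_sd_sqr n p hp) as e.
  pose proof (lt_0_INR n ltac:(lia)).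
  assert (hx : x * h = (INR k - INR n * p) / (INR n * p * (1 - p))).
  { rewrite <- e. unfold x, h, binom_std. field; lra. }
  replace (x * (1 - p) * h) with (x * h * (1 - p)) by ring.
  replace (x * p * h) with (x * h * p) by ring. rewrite hx.
  field; lra.
Qed.

Lemma binom_std_nonneg (n k : nat) (p : R) : (1 <= n)%nat -> 0 < p < 1 ->
  INR n * p <= INR k -> 0 <= binom_std n p k.
Proof.
  intros hn hp hk. apply Rdiv_le_0_compat; [lra | now apply binom_sd_pos].
Qed.

Lemma binom_tail_le (n m : nat) (p : R) (G : R -> R) : (1 <= n)%nat -> (m <= n)%nat -> 0 < p < 1 ->
  let h := / binom_sd n p in
  (forall k, (m <= k <= n)%nat -> let x := binom_std n p k in
     h <= (1 + x * (1 - p) * h) * G x - (1 - x * p * h) * G (x + h)) ->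
  sum_f m n (binom_term n p) <= tail_approx n p G m.
Proof.
  intros hn hmn hp h hG.
  rewrite <- (Rminus_0_r (tail_approx n p G m)), <- (tail_approx_next_last n p G).
  apply sum_f_le_telescope; auto.
  - intros k hk. rewrite tail_approx_sub by auto.
    pose proof (binom_sd_pos n p hn hp). pose proof (binom_term_pos n k p hp).
    assert (0 < binom_sd n p * binom_term n p k) by now apply Rmult_lt_0_compat.
    (* Since [binom_sd n p * h = 1], a factor of at least [h] leaves at least the weight itself. *)
    replace (binom_term n p k) with (binom_sd n p * binom_term n p k * h) at 1
      by (unfold h; field; lra).
    apply Rmult_le_compat_l; [lra | now apply hG].
  - intros k hk. apply tail_approx_next_eq; auto; lia.
Qed.

Lemma binom_tail_ge (n m : nat) (p : R) (G : R -> R) : (1 <= n)%nat -> (m <= n)%nat -> 0 < p < 1 ->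
  let h := / binom_sd n p in
  (forall k, (m <= k <= n)%nat -> let x := binom_std n p k in
     (1 + x * (1 - p) * h) * G x - (1 - x * p * h) * G (x + h) <= h) ->
  tail_approx n p G m <= sum_f m n (binom_term n p).
Proof.
  intros hn hmn hp h hG.
  rewrite <- (Rminus_0_r (tail_approx n p G m)), <- (tail_approx_next_last n p G).
  apply sum_f_ge_telescope; auto.
  - intros k hk. rewrite tail_approx_sub by auto.
    pose proof (binom_sd_pos n p hn hp). pose proof (binom_term_pos n k p hp).
    assert (0 < binom_sd n p * binom_term n p k) by now apply Rmult_lt_0_compat.
    replace (binom_term n p k) with (binom_sd n p * binom_term n p k * h) at 2
      by (unfold h; field; lra).
    apply Rmult_le_compat_l; [lra | now apply hG].
  - intros k hk. apply tail_approx_next_eq; auto; lia.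
Qed.

Lemma binom_std_ge (n m k : nat) (p : R) : (1 <= n)%nat -> 0 < p < 1 -> (m <= k)%nat ->
  binom_std n p m <= binom_std n p k.
Proof.
  intros hn hp hk. pose proof (binom_sd_pos n p hn hp).
  unfold binom_std, Rdiv. apply Rmult_le_compat_r.
  - left; now apply Rinv_0_lt_compat.
  - apply le_INR in hk; lra.
Qed.

(** The left-hand side is [(k - n p) / (n (1 - p))], so the bound amounts to [k <= n]. It supplies
    the side condition of [mills_step_ge_inv]. *)
Lemma binom_std_p_h (n k : nat) (p : R) : (1 <= k <= n)%nat -> 0 < p < 1 ->
  binom_std n p k * p * / binom_sd n p <= 1.
Proof.
  intros hk hp. pose proof (binom_sd_pos n p ltac:(lia) hp).
  pose proof (binom_sd_sqr n p hp) as e. pose proof (lt_0_INR n ltac:(lia)).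
  replace (binom_std n p k * p * / binom_sd n p) with ((INR k - INR n * p) * p / (INR n * p * (1 - p)))
    by (rewrite <- e; unfold binom_std; field; lra).
  apply Rmult_le_reg_r with (INR n * p * (1 - p)).
  - repeat apply Rmult_lt_0_compat; lra.
  - unfold Rdiv; rewrite Rmult_assoc, Rinv_l.
    + assert (INR k <= INR n) by (apply le_INR; lia). nra.
    + apply Rgt_not_eq. repeat apply Rmult_lt_0_compat; lra.
Qed.

(** * Bounds of the binomial tail by the Mills ratio *)

Lemma binom_tail_ge_mills (J : R -> R) (n m : nat) (p : R) :
  gauss_tail J -> (1 <= n)%nat -> (m <= n)%nat -> 0 < p < 1 -> INR n * p <= INR m ->
  tail_approx n p (mills J) m <= sum_f m n (binom_term n p).
Proof.
  intros hJ hn hmn hp hm. apply binom_tail_ge; auto.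
  intros k hk x. apply mills_step_le; auto; try lra.
  - apply binom_std_nonneg; auto. assert (INR m <= INR k) by (apply le_INR; lia). lra.
  - left; now apply Rinv_0_lt_compat, binom_sd_pos.
Qed.

Lemma binom_tail_le_mills_exp (J : R -> R) (n m : nat) (p : R) :
  gauss_tail J -> (1 <= n)%nat -> (m <= n)%nat -> 0 < p < 1 -> INR n * p <= INR m ->
  sum_f m n (binom_term n p)
  <= tail_approx n p (mills J) m * exp (mills J 0 / 2 * / binom_sd n p).
Proof.
  intros hJ hn hmn hp hm.
  set (e := exp _).
  replace (tail_approx n p (mills J) m * e)
    with (tail_approx n p (fun x => e * mills J x) m) by (unfold tail_approx; ring).
  apply binom_tail_le; auto.
  intros k hk x.
  assert (hh : 0 < / binom_sd n p) by now apply Rinv_0_lt_compat, binom_sd_pos.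
  assert (hx : 0 <= x).
  { apply binom_std_nonneg; auto. assert (INR m <= INR k) by (apply le_INR; lia). lra. }
  (* Multiplying this inequality by [e] turns its lower bound [h / e] into [h]. *)
  pose proof (mills_step_ge_exp J p (1 - p) x (/ binom_sd n p) hJ ltac:(lra) ltac:(lra)
    ltac:(lra) hx ltac:(lra)) as H.
  rewrite exp_Ropp in H. fold e in H.
  assert (he : 0 < e) by apply exp_pos.
  apply (Rmult_le_compat_l e) in H; [|lra].
  replace (e * (/ binom_sd n p * / e)) with (/ binom_sd n p) in H
    by (pose proof (binom_sd_pos n p hn hp); field; split; lra).
  lra.
Qed.

Lemma binom_tail_le_mills_inv (J : R -> R) (n m : nat) (p : R) :
  gauss_tail J -> (1 <= n)%nat -> (1 <= m <= n)%nat -> 0 < p < 1 -> INR n * p < INR m ->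
  sum_f m n (binom_term n p)
  <= tail_approx n p (mills J) m * (1 + / (INR m - INR n * p)).
Proof.
  intros hJ hn hmn hp hm.
  pose proof (binom_sd_pos n p hn hp) as hs.
  set (G := fun x => mills J x * (1 + / binom_sd n p / x)).
  replace (tail_approx n p (mills J) m * (1 + / (INR m - INR n * p)))
    with (tail_approx n p G m).
  2: { unfold tail_approx, G.
       (* The correction [h / x_m] does not depend on sigma, which cancels. *)
       replace (/ (INR m - INR n * p)) with (/ binom_sd n p / binom_std n p m); [ring|].
       unfold binom_std. field; lra. }
  apply binom_tail_le; auto; [lia|].
  intros k hk x. unfold G.
  apply mills_step_ge_inv; auto; try lra.
  - unfold x. apply Rlt_le_trans with (binom_std n p m); [|apply binom_std_ge; auto; lia].
    unfold binom_std. apply Rdiv_lt_0_compat; lra.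
  - left; now apply Rinv_0_lt_compat.
  - apply binom_std_p_h; auto; lia.
Qed.

(** * Wallis integrals *)

(** The integrand is the derivative of [cos x ^ (n + 1) * sin x], which vanishes at both ends. *)
Lemma is_RInt_cos_pow_rec (n : nat) :
  is_RInt (fun x => INR (n + 2) * cos x ^ (n + 2) - INR (n + 1) * cos x ^ n) 0 (PI / 2) 0.
Proof.
  replace 0 with (minus (cos (PI / 2) ^ (n + 1) * sin (PI / 2)) (cos 0 ^ (n + 1) * sin 0)) at 2.
  - apply (is_RInt_derive (fun x => cos x ^ (n + 1) * sin x)).
    + intros x _. auto_derive; auto.
      replace (Nat.pred (n + 1)) with n by lia.
      rewrite !plus_INR. simpl INR.
      replace (cos x ^ (n + 2)) with (cos x ^ n * (cos x)²) by (rewrite pow_add; unfold Rsqr; ring).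
      replace (cos x ^ (n + 1)) with (cos x ^ n * cos x) by (rewrite pow_add; ring).
      pose proof (sin2 x) as e. unfold Rsqr in *.
      transitivity (cos x ^ n * (cos x * cos x) - (INR n + 1) * cos x ^ n * (sin x * sin x)); [ring|].
      rewrite e; ring.
    + intros x _. apply (ex_derive_continuous (fun x => INR (n + 2) * cos x ^ (n + 2) - INR (n + 1) * cos x ^ n)).
      auto_derive; auto.
  - rewrite cos_PI2, sin_0. rewrite pow_i by lia. unfold minus, plus, opp; simpl; ring.
Qed.

Definition cos_int (n : nat) : R := RInt (fun x => cos x ^ n) 0 (PI / 2).

Lemma ex_RInt_cos_pow (n : nat) : ex_RInt (fun x => cos x ^ n) 0 (PI / 2).
Proof.
  apply (ex_RInt_continuous (fun x => cos x ^ n)). intros x _.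
  apply (ex_derive_continuous (fun x => cos x ^ n)). auto_derive; auto.
Qed.

Lemma cos_int_rec (n : nat) : INR (n + 2) * cos_int (n + 2) = INR (n + 1) * cos_int n.
Proof.
  apply Rminus_diag_uniq. rewrite <- (is_RInt_unique _ _ _ _ (is_RInt_cos_pow_rec n)).
  symmetry. apply is_RInt_unique.
  apply (is_RInt_minus (fun x => INR (n + 2) * cos x ^ (n + 2)) (fun x => INR (n + 1) * cos x ^ n)).
  - apply (is_RInt_scal (fun x => cos x ^ (n + 2))). apply (RInt_correct (fun x => cos x ^ (n + 2))), ex_RInt_cos_pow.
  - apply (is_RInt_scal (fun x => cos x ^ n)). apply (RInt_correct (fun x => cos x ^ n)), ex_RInt_cos_pow.
Qed.

Lemma cos_int_decr (n : nat) : cos_int (S n) <= cos_int n.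
Proof.
  pose proof PI_RGT_0.
  apply RInt_le; try apply ex_RInt_cos_pow; [lra|].
  intros x hx. pose proof (COS_bound x). pose proof (cos_gt_0 x ltac:(lra) ltac:(lra)).
  pose proof (pow_lt (cos x) n ltac:(lra)). simpl. nra.
Qed.

Lemma cos_int_0 : cos_int 0 = PI / 2.
Proof.
  unfold cos_int. simpl. rewrite RInt_const. unfold scal; simpl; unfold mult; simpl. ring.
Qed.

Lemma cos_int_1 : cos_int 1 = 1.
Proof.
  unfold cos_int. apply is_RInt_unique.
  replace 1 with (minus (sin (PI / 2)) (sin 0)) by (rewrite sin_PI2, sin_0; unfold minus, plus, opp; simpl; ring).
  apply (is_RInt_derive sin).
  - intros x _. auto_derive; auto; simpl; ring.
  - intros x _. apply (ex_derive_continuous (fun x => cos x ^ 1)). auto_derive; auto.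
Qed.

(** The probability of [j] heads in [2 * j] tosses of a fair coin. *)
Definition central (j : nat) : R := Binomial.C (2 * j) j / 4 ^ j.

Lemma central_pos (j : nat) : 0 < central j.
Proof. apply Rdiv_lt_0_compat; [apply C_pos | apply pow_lt; lra]. Qed.

Lemma central_succ (j : nat) :
  central (S j) * (2 * INR j + 2) = central j * (2 * INR j + 1).
Proof.
  unfold central, Binomial.C.
  replace (2 * S j)%nat with (S (S (2 * j))) by lia.
  replace (S (S (2 * j)) - S j)%nat with (S j) by lia.
  replace (2 * j - j)%nat with j by lia.
  rewrite !fact_simpl, !mult_INR, !S_INR, mult_INR. simpl INR. simpl pow.
  pose proof (INR_fact_neq_0 j). pose proof (pos_INR j). pose proof (pow_lt 4 j ltac:(lra)).
  field. repeat split; lra.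
Qed.

Lemma cos_int_even (j : nat) : cos_int (2 * j) = PI / 2 * central j.
Proof.
  induction j as [|j IH].
  - simpl. rewrite cos_int_0. unfold central, Binomial.C. simpl. field.
  - pose proof (cos_int_rec (2 * j)) as e. rewrite IH in e.
    replace (2 * S j)%nat with (2 * j + 2)%nat by lia.
    rewrite !plus_INR, mult_INR in e. simpl INR in e.
    pose proof (central_succ j) as hc. pose proof (pos_INR j).
    apply Rmult_eq_reg_l with ((1 + 1) * INR j + (1 + 1)); [|lra].
    rewrite e. transitivity (PI / 2 * (central (S j) * (2 * INR j + 2))); [rewrite hc|]; ring.
Qed.

(** The recursion of [(2 j + 1) * cos_int (2 j + 1)] is inverse to that of [central], so the product
    stays constant. *)
Lemma cos_int_odd (j : nat) : cos_int (2 * j + 1) * ((2 * INR j + 1) * central j) = 1.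
Proof.
  induction j as [|j IH].
  - simpl. rewrite cos_int_1. unfold central, Binomial.C. simpl. field.
  - pose proof (cos_int_rec (2 * j + 1)) as e.
    replace (2 * S j + 1)%nat with (2 * j + 1 + 2)%nat by lia.
    rewrite !plus_INR, mult_INR in e. simpl INR in e.
    pose proof (central_succ j) as hc. pose proof (pos_INR j). rewrite S_INR.
    apply Rmult_eq_reg_l with (2 * INR j + 2); [|lra].
    transitivity ((((1 + 1) * INR j + 1 + (1 + 1)) * cos_int (2 * j + 1 + 2)) * (central (S j) * (2 * INR j + 2))); [ring|].
    rewrite e, hc.
    transitivity ((2 * INR j + 2) * (cos_int (2 * j + 1) * ((2 * INR j + 1) * central j))); [ring|].
    now rewrite IH.
Qed.

(** Wallis: [cos_int (2 j + 1) <= cos_int (2 j)], multiplied by [(2 j + 1) * central j]. *)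
Lemma central_sqr_ge (j : nat) : 2 <= PI * (2 * INR j + 1) * central j ^ 2.
Proof.
  pose proof (cos_int_decr (2 * j)) as H. rewrite cos_int_even in H.
  pose proof (cos_int_odd j) as e. replace (2 * j + 1)%nat with (S (2 * j)) in e by lia.
  pose proof (central_pos j). pose proof (pos_INR j).
  assert (0 < (2 * INR j + 1) * central j) by (apply Rmult_lt_0_compat; lra).
  apply (Rmult_le_compat_r ((2 * INR j + 1) * central j)) in H; lra.
Qed.

(** Wallis, from the other neighbour: [cos_int (2 j + 2) <= cos_int (2 j + 1)], stated for [S j]. *)
Lemma central_sqr_le (j : nat) : PI * INR j * central j ^ 2 <= 1.
Proof.
  destruct j as [|j]; [simpl; lra|].
  pose proof (cos_int_decr (2 * j + 1)) as H.
  replace (S (2 * j + 1)) with (2 * S j)%nat in H by lia. rewrite cos_int_even in H.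
  pose proof (cos_int_odd j) as e. rewrite (Rmult_comm _ (central j)), <- central_succ in e.
  pose proof (central_pos (S j)). pose proof (pos_INR j). rewrite S_INR.
  assert (0 < (2 * INR j + 2) * central (S j)) by (apply Rmult_lt_0_compat; lra).
  apply (Rmult_le_compat_r ((2 * INR j + 2) * central (S j))) in H; lra.
Qed.

(** * The Gaussian integral from the symmetric binomial *)

Lemma sum_f_R0_reverse (f : nat -> R) (n : nat) :
  sum_f_R0 f n = sum_f_R0 (fun i => f (n - i)%nat) n.
Proof.
  induction n as [|n IH]; [reflexivity|].
  rewrite (decomp_sum (fun i => f (S n - i)%nat)) by lia. simpl pred.
  rewrite (sum_eq (fun i => f (S n - S i)%nat) (fun i => f (n - i)%nat))
    by (intros; now rewrite Nat.sub_succ).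
  rewrite <- IH. simpl. ring.
Qed.

(** An odd number of trials has no middle term, so the reflection [i -> n - i] exchanges the two
    halves of a total of 1. *)
Lemma binom_half_tail (j : nat) :
  sum_f (S j) (2 * j + 1) (binom_term (2 * j + 1) (1 / 2)) = 1 / 2.
Proof.
  set (n := (2 * j + 1)%nat). set (b := binom_term n (1 / 2)).
  assert (hsym : forall i, (i <= n)%nat -> b (n - i)%nat = b i).
  { intros i hi. unfold b, binom_term.
    rewrite <- (pascal_step1 n i hi).
    replace (n - (n - i))%nat with i by lia.
    replace (1 - 1 / 2) with (1 / 2) by field. ring. }
  assert (htot : sum_f_R0 b n = 1).
  { transitivity ((1 / 2 + (1 - 1 / 2)) ^ n); [now rewrite binomial|].
    replace (1 / 2 + (1 - 1 / 2)) with 1 by field. apply pow1. }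
  assert (e1 : sum_f (S j) n b = sum_f_R0 b n - sum_f_R0 b j) by (apply sum_f_rw; unfold n; lia).
  assert (e2 : sum_f (S j) n b = sum_f_R0 b j).
  { unfold sum_f. replace (n - S j)%nat with j by (unfold n; lia).
    rewrite (sum_f_R0_reverse b j).
    apply sum_eq. intros i hi.
    rewrite <- hsym by (unfold n; lia). f_equal. unfold n; lia. }
  lra.
Qed.

(** Here sigma is [sqrt n / 2], the standardized point is [/ sqrt n], and the remaining factor is
    the weight of [j] in [2 * j] trials. *)
Lemma binom_half_approx (j : nat) (G : R -> R) :
  let n := (2 * j + 1)%nat in
  tail_approx n (1 / 2) G (S j) = sqrt (INR n) / 2 * central j * G (/ sqrt (INR n)).
Proof.
  intros n.
  assert (hn : 0 < INR n) by (apply lt_0_INR; unfold n; lia).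
  pose proof (sqrt_lt_R0 _ hn) as hs. pose proof (sqrt_sqrt (INR n) ltac:(lra)) as hss.
  assert (hsd : binom_sd n (1 / 2) = sqrt (INR n) / 2).
  { unfold binom_sd. replace (INR n * (1 / 2) * (1 - 1 / 2)) with (Rsqr (sqrt (INR n) / 2)).
    - apply sqrt_Rsqr; lra.
    - unfold Rsqr; lra. }
  assert (hj : INR n = 2 * INR j + 1) by (unfold n; rewrite plus_INR, mult_INR; simpl; ring).
  unfold tail_approx, binom_std. rewrite hsd.
  replace ((INR (S j) - INR n * (1 / 2)) / (sqrt (INR n) / 2)) with (/ sqrt (INR n)).
  2: { rewrite S_INR. field_simplify; [|lra|lra]. rewrite hj at 2. field_simplify; [|lra|lra].
       f_equal; ring. }
  assert (hb : binom_term n (1 / 2) (S j) * (INR (S j) / (INR n * (1 / 2))) = central j).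
  { unfold binom_term, central, Binomial.C.
    replace (2 * j - j)%nat with j by lia. unfold n at 1 2 3.
    replace (2 * j + 1 - S j)%nat with j by lia.
    replace (2 * j + 1)%nat with (S (2 * j)) by lia.
    rewrite !fact_simpl, !mult_INR.
    replace (1 - 1 / 2) with (1 / 2) by field.
    replace (4 ^ j) with (2 ^ j * 2 ^ j) by (rewrite <- Rpow_mult_distr; f_equal; ring).
    replace (INR (S (2 * j))) with (INR n) by (f_equal; unfold n; lia).
    replace (1 / 2) with (/ 2) by field. rewrite !pow_inv. simpl pow.
    pose proof (INR_fact_neq_0 j). pose proof (lt_0_INR (S j) ltac:(lia)).
    pose proof (pow_lt 2 j ltac:(lra)).
    field. repeat split; lra. }
  rewrite <- hb. field; lra.
Qed.

(** The tail 1/2 gives [sqrt n * central j * mills J x <= 1] at [x = / sqrt n], and [central_sqr_ge]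
    bounds [sqrt n * central j] below by [sqrt (2 / PI)]. Letting [j] grow moves [x] to 0. *)
Lemma mills_zero_le (J : R -> R) : gauss_tail J -> mills J 0 <= sqrt (PI / 2).
Proof.
  intros hJ. pose proof PI_RGT_0 as hpi.
  apply Rle_plus_epsilon. intros eps heps.
  destruct (archimed_cor1 (eps * eps) ltac:(nra)) as [j [hj hj0]].
  set (n := (2 * j + 1)%nat).
  assert (hn : 0 < INR n) by (apply lt_0_INR; unfold n; lia).
  pose proof (sqrt_lt_R0 _ hn) as hs. pose proof (sqrt_sqrt (INR n) ltac:(lra)) as hss.
  assert (hnj : INR n = 2 * INR j + 1) by (unfold n; rewrite plus_INR, mult_INR; simpl; ring).
  assert (hsmall : / sqrt (INR n) < eps).
  { rewrite <- sqrt_inv. apply Rsqr_incrst_0; [| apply sqrt_pos | lra].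
    rewrite Rsqr_sqrt by (left; now apply Rinv_0_lt_compat).
    apply Rle_lt_trans with (/ INR j); [|exact hj].
    apply Rinv_le_contravar; [now apply lt_0_INR | pose proof (pos_INR j); lra]. }
  set (x := / sqrt (INR n)) in *.
  assert (hx : 0 < x) by now apply Rinv_0_lt_compat.
  (* The one-step inequality at the point 0 with step [x], where the terms in [p] and [q] vanish. *)
  assert (h1 : mills J 0 <= mills J x + x).
  { pose proof (mills_step_le J 0 1 0 x hJ ltac:(lra) ltac:(lra) ltac:(lra) ltac:(lra) ltac:(lra)) as H.
    rewrite Rplus_0_l in H. lra. }
  assert (h2 : sqrt (INR n) * central j * mills J x <= 1).
  { pose proof (binom_tail_ge_mills J n (S j) (1 / 2) hJ ltac:(unfold n; lia) ltac:(unfold n; lia)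
      ltac:(lra) ltac:(rewrite S_INR; lra)) as H.
    unfold n in H. rewrite binom_half_tail, binom_half_approx in H. fold n in H. fold x in H. lra. }
  assert (h3 : 1 <= sqrt (PI / 2) * (sqrt (INR n) * central j)).
  { pose proof (central_sqr_ge j) as hc. rewrite <- hnj in hc. pose proof (central_pos j).
    pose proof (sqrt_pos (PI / 2)). pose proof (sqrt_sqrt (PI / 2) ltac:(lra)) as hpp.
    apply Rsqr_incr_0; unfold Rsqr; [|lra |].
    2: { apply Rmult_le_pos; [assumption|]. left; now apply Rmult_lt_0_compat. }
    replace (sqrt (PI / 2) * (sqrt (INR n) * central j) * (sqrt (PI / 2) * (sqrt (INR n) * central j)))
      with ((sqrt (PI / 2) * sqrt (PI / 2)) * (sqrt (INR n) * sqrt (INR n)) * central j ^ 2) by ring.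
    rewrite hpp, hss. lra. }
  assert (h4 : mills J x <= sqrt (PI / 2)).
  { pose proof (central_pos j).
    assert (0 < sqrt (INR n) * central j) by now apply Rmult_lt_0_compat.
    apply Rmult_le_reg_l with (sqrt (INR n) * central j); [assumption|]. lra. }
  lra.
Qed.

(** * Stirling's formula *)

(** The logarithm is [2 * (u + u ^ 3 / 3 + u ^ 5 / 5 + ...)]; the upper bound replaces the terms
    from the cubic on by a geometric series of ratio [u ^ 2]. *)
Lemma ln_ratio_bounds (u : R) : 0 <= u < 1 ->
  2 * u <= ln ((1 + u) / (1 - u)) <= 2 * u + 2 * u ^ 3 / (3 * (1 - u ^ 2)).
Proof.
  intros hu.
  assert (e0 : ln ((1 + 0) / (1 - 0)) = 0) by (replace ((1 + 0) / (1 - 0)) with 1 by field; apply ln_1).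
  assert (hd : forall x, 0 <= x <= u -> is_derive (fun x => ln ((1 + x) / (1 - x))) x (2 / (1 - x ^ 2))).
  { intros x hx. auto_derive.
    - split; [lra|]. split; [apply Rdiv_lt_0_compat; lra | auto].
    - field. repeat split; nra. }
  split.
  - assert (H : ln ((1 + 0) / (1 - 0)) - 2 * 0 <= ln ((1 + u) / (1 - u)) - 2 * u).
    { apply (le_of_derive_nonneg (fun x => ln ((1 + x) / (1 - x)) - 2 * x)
        (fun x => 2 / (1 - x ^ 2) - 2)); [lra | |].
      - intros x hx. apply (is_derive_minus (fun x => ln ((1 + x) / (1 - x))) (fun x => 2 * x)); [now apply hd|].
        auto_derive; auto; ring.
      - intros x hx. replace (2 / (1 - x ^ 2) - 2) with (2 * x ^ 2 / (1 - x ^ 2)) by (field; nra).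
        apply Rdiv_le_0_compat; nra. }
    lra.
  - assert (H : 2 * 0 + 2 * 0 ^ 3 / (3 * (1 - 0 ^ 2)) - ln ((1 + 0) / (1 - 0))
      <= 2 * u + 2 * u ^ 3 / (3 * (1 - u ^ 2)) - ln ((1 + u) / (1 - u))).
    { apply (le_of_derive_nonneg (fun x => 2 * x + 2 * x ^ 3 / (3 * (1 - x ^ 2)) - ln ((1 + x) / (1 - x)))
        (fun x => 4 / 3 * x ^ 4 / (1 - x ^ 2) ^ 2)); [lra | |].
      - intros x hx. eapply is_derive_eq.
        + apply (is_derive_minus (fun x => 2 * x + 2 * x ^ 3 / (3 * (1 - x ^ 2))) (fun x => ln ((1 + x) / (1 - x)))); [|now apply hd].
          auto_derive; [nra | reflexivity].
        + unfold minus, plus, opp; simpl. field. nra.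
      - intros x hx. apply Rdiv_le_0_compat; [|apply pow_lt; nra].
        pose proof (pow_le x 4 ltac:(lra)). lra. }
    replace (2 * 0 + 2 * 0 ^ 3 / (3 * (1 - 0 ^ 2))) with 0 in H by field. lra.
Qed.

(** The logarithm of [n!] over [n ^ n * exp (- n) * sqrt n]; the remainder [r_n] is this minus
    [ln (2 * PI) / 2]. *)
Definition stirling (n : nat) : R :=
  ln (INR (fact n)) - INR n * ln (INR n) + INR n - ln (INR n) / 2.

Lemma stirling_step (n : nat) : (1 <= n)%nat ->
  0 <= stirling n - stirling (S n) <= / (12 * INR n) - / (12 * INR (S n)).
Proof.
  intros hn. pose proof (lt_0_INR n ltac:(lia)) as hn0.
  assert (e : stirling n - stirling (S n) = (INR n + / 2) * ln ((INR n + 1) / INR n) - 1).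
  { unfold stirling. rewrite fact_simpl, mult_INR, S_INR.
    rewrite ln_mult, ln_div by (try apply INR_fact_lt_0; lra). field. }
  (* Chosen so that [(1 + u) / (1 - u) = (n + 1) / n]. Then [(n + 1 / 2) * 2 u = 1], and the cubic
     term of the upper bound becomes exactly [1 / (12 n) - 1 / (12 (n + 1))]. *)
  set (u := / (2 * INR n + 1)).
  assert (hu : 0 < u < 1).
  { split; [apply Rinv_0_lt_compat; lra|]. rewrite <- Rinv_1. apply Rinv_lt_contravar; lra. }
  assert (hr : (INR n + 1) / INR n = (1 + u) / (1 - u)).
  { unfold u. field. lra. }
  destruct (ln_ratio_bounds u ltac:(lra)) as [h1 h2]. rewrite <- hr in h1, h2.
  rewrite e, S_INR.
  assert (hc : 0 < INR n + / 2) by lra.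
  apply (Rmult_le_compat_l (INR n + / 2)) in h1; [|lra].
  apply (Rmult_le_compat_l (INR n + / 2)) in h2; [|lra].
  replace ((INR n + / 2) * (2 * u)) with 1 in h1 by (unfold u; field; lra).
  replace ((INR n + / 2) * (2 * u + 2 * u ^ 3 / (3 * (1 - u ^ 2))))
    with (1 + (/ (12 * INR n) - / (12 * (INR n + 1)))) in h2.
  - lra.
  - unfold u. field. repeat split; nra.
Qed.

Lemma stirling_bounds_add (n k : nat) : (1 <= n)%nat ->
  0 <= stirling n - stirling (n + k) <= / (12 * INR n) - / (12 * INR (n + k)).
Proof.
  intros hn. induction k as [|k IH].
  - rewrite Nat.add_0_r. lra.
  - rewrite Nat.add_succ_r. pose proof (stirling_step (n + k) ltac:(lia)). lra.
Qed.

(** If [stirling] has limit c, this combination also tends to c; it involves only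
    [n * central n ^ 2], so Wallis' inequalities determine c. *)
Lemma stirling_double (n : nat) : (1 <= n)%nat ->
  2 * stirling n - stirling (2 * n) = ln 2 / 2 - ln (INR n * central n ^ 2) / 2.
Proof.
  intros hn. pose proof (lt_0_INR n ltac:(lia)) as hn0.
  pose proof (INR_fact_lt_0 n). pose proof (INR_fact_lt_0 (2 * n)).
  assert (e2 : INR (2 * n) = 2 * INR n) by (rewrite mult_INR; simpl; ring).
  assert (e4 : ln (4 ^ n) = INR n * (2 * ln 2)).
  { rewrite ln_pow by lra. replace 4 with (2 * 2) by ring. rewrite ln_mult by lra. ring. }
  assert (hc : ln (central n) = ln (INR (fact (2 * n))) - 2 * ln (INR (fact n)) - INR n * (2 * ln 2)).
  { unfold central, Binomial.C. replace (2 * n - n)%nat with n by lia.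
    rewrite ln_div, ln_div, ln_mult, e4; auto.
    - ring.
    - now apply Rmult_lt_0_compat.
    - apply Rdiv_lt_0_compat; auto. now apply Rmult_lt_0_compat.
    - apply pow_lt; lra. }
  pose proof (central_pos n).
  rewrite ln_mult, ln_pow, hc; [|auto| auto | now apply pow_lt].
  unfold stirling. rewrite e2, ln_mult by lra. simpl INR. field.
Qed.

Lemma stirling_double_bounds (n : nat) : (1 <= n)%nat ->
  ln (2 * PI) / 2 <= 2 * stirling n - stirling (2 * n) <= ln (2 * PI) / 2 + / INR n.
Proof.
  intros hn. rewrite stirling_double by exact hn.
  pose proof (lt_0_INR n ltac:(lia)) as hn0. pose proof PI_RGT_0 as hpi.
  pose proof (central_sqr_le n) as hle. pose proof (central_sqr_ge n) as hge.
  pose proof (pow_lt _ 2 (central_pos n)) as hc.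
  rewrite ln_mult by lra.
  set (w := INR n * central n ^ 2). assert (hw : 0 < w) by now apply Rmult_lt_0_compat.
  assert (h1 : ln PI + ln w <= 0).
  { rewrite <- ln_mult by auto. rewrite <- ln_1. apply ln_le; [now apply Rmult_lt_0_compat|]. unfold w; lra. }
  assert (h2 : 0 <= ln PI + ln w + / INR n).
  { pose proof (exp_ineq1_le (/ INR n)) as hexp.
    rewrite <- (ln_exp (/ INR n)), <- !ln_mult, <- ln_1 by (auto; try apply exp_pos; now apply Rmult_lt_0_compat).
    apply ln_le; [lra|].
    assert (hpw : 0 < PI * w) by now apply Rmult_lt_0_compat.
    apply Rle_trans with (PI * w * (1 + / INR n)); [|now apply Rmult_le_compat_l; [lra|]].
    replace (PI * w * (1 + / INR n)) with (PI * (INR n + 1) * central n ^ 2) by (unfold w; field; lra).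
    assert (0 < PI * central n ^ 2) by now apply Rmult_lt_0_compat. nra. }
  pose proof (Rinv_0_lt_compat _ hn0). lra.
Qed.

(** For large [N], [stirling N] is [2 * stirling N - stirling (2 N)] minus
    [stirling N - stirling (2 N)]; the first is near [ln (2 * PI) / 2], the second near 0.
    [stirling_bounds_add] carries this back from [N] to [n]. *)
Lemma stirling_bounds (n : nat) : (1 <= n)%nat ->
  ln (2 * PI) / 2 <= stirling n <= ln (2 * PI) / 2 + / (12 * INR n).
Proof.
  intros hn. pose proof (lt_0_INR n ltac:(lia)) as hn0.
  assert (hlim : forall eps, 0 < eps ->
    ln (2 * PI) / 2 - eps <= stirling n <= ln (2 * PI) / 2 + / (12 * INR n) + eps).
  { intros eps heps.
    destruct (archimed_cor1 eps heps) as [k [hk hk0]].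
    set (N := (n + k)%nat).
    pose proof (stirling_bounds_add n k hn) as hb. fold N in hb.
    pose proof (stirling_bounds_add N N ltac:(unfold N; lia)) as hd.
    replace (N + N)%nat with (2 * N)%nat in hd by lia.
    pose proof (stirling_double_bounds N ltac:(unfold N; lia)) as he.
    assert (hN : 0 < INR N) by (apply lt_0_INR; unfold N; lia).
    assert (hNk : / INR N <= / INR k) by (apply Rinv_le_contravar; [now apply lt_0_INR | apply le_INR; unfold N; lia]).
    assert (hi : / (12 * INR N) = / 12 * / INR N) by (field; lra).
    assert (hi2 : 0 < / (12 * INR (2 * N))) by (apply Rinv_0_lt_compat; rewrite mult_INR; simpl; lra).
    pose proof (Rinv_0_lt_compat _ hN).
    rewrite hi in *. lra. }
  split; apply Rle_plus_epsilon; intros eps heps; specialize (hlim eps heps); lra.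
Qed.

(** [d] equals [r_n - r_m - r_(n-m)]. The upper bound uses [r_n <= r_m] and [0 <= r_(n-m)]; the
    lower one uses [0 <= r_n] and [1 / m + 1 / (n - m) = 1 / (n t (1 - t))]. *)
Lemma binomial_stirling (n m : nat) : (1 <= m < n)%nat ->
  let t := INR m / INR n in
  let d := ln (Binomial.C n m * t ^ m * (1 - t) ^ (n - m))
           + / 2 * ln (2 * PI * INR n * t * (1 - t)) in
  - / (12 * INR n * t * (1 - t)) <= d <= 0.
Proof.
  intros hm t d. pose proof PI_RGT_0 as hpi.
  pose proof (lt_0_INR n ltac:(lia)) as hn0. pose proof (lt_0_INR m ltac:(lia)) as hm0.
  pose proof (lt_0_INR (n - m) ltac:(lia)) as hk0.
  assert (hk : INR (n - m) = INR n - INR m) by (apply minus_INR; lia).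
  assert (ht1 : 1 - t = INR (n - m) / INR n) by (rewrite hk; unfold t; field; lra).
  assert (hr : 0 < t) by now apply Rdiv_lt_0_compat.
  assert (hr1 : 0 < 1 - t) by (rewrite ht1; now apply Rdiv_lt_0_compat).
  assert (hd : d = ln (2 * PI) / 2 + stirling n - stirling m - stirling (n - m)).
  { unfold d.
    pose proof (C_pos n m) as hC. pose proof (pow_lt t m hr). pose proof (pow_lt (1 - t) (n - m) hr1).
    pose proof (Rmult_lt_0_compat _ _ hC H).
    assert (0 < PI * INR n) by now apply Rmult_lt_0_compat.
    replace (2 * PI * INR n * t * (1 - t)) with (2 * (PI * INR n) * (t * (1 - t))) by ring.
    assert (0 < 2 * (PI * INR n)) by lra.
    assert (0 < t * (1 - t)) by now apply Rmult_lt_0_compat.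
    rewrite !ln_mult by (assumption || lra).
    rewrite !ln_pow, ht1 by lra. unfold t. rewrite !ln_div by lra.
    unfold Binomial.C, Rdiv.
    pose proof (INR_fact_lt_0 n). pose proof (INR_fact_lt_0 m). pose proof (INR_fact_lt_0 (n - m)).
    rewrite ln_mult, ln_Rinv, ln_mult; auto.
    2,3: try apply Rinv_0_lt_compat; now apply Rmult_lt_0_compat.
    unfold stirling. replace (INR n) with (INR m + INR (n - m)) by lra. field. }
  rewrite hd.
  pose proof (stirling_bounds n ltac:(lia)). pose proof (stirling_bounds m ltac:(lia)).
  pose proof (stirling_bounds (n - m) ltac:(lia)).
  pose proof (stirling_bounds_add m (n - m) ltac:(lia)) as hadd.
  replace (m + (n - m))%nat with n in hadd by lia.
  replace (/ (12 * INR n * t * (1 - t))) with (/ (12 * INR m) + / (12 * INR (n - m))).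
  - lra.
  - unfold t. rewrite hk. field. lra.
Qed.

(** * The binomial tail *)

(** [J y = I - RInt f x y], whose limit 0 at infinity is the hypothesis itself. *)
Lemma gauss_tail_of_improper_int (x I : R) :
  improper_int_to_infty (fun s => exp (- (s ^ 2) / 2)) x I ->
  exists J, gauss_tail J /\ J x = I.
Proof.
  intros hI. set (f := fun s => exp (- (s ^ 2) / 2)) in *.
  assert (hf : forall y, continuous f y).
  { intros y. apply (ex_derive_continuous f). unfold f. auto_derive; auto. }
  assert (hex : forall a b, ex_RInt f a b).
  { intros a b. apply (ex_RInt_continuous f). intros; apply hf. }
  exists (fun y => I - RInt f x y). refine (conj (conj _ _) _).
  - intros y. eapply is_derive_eq.
    + apply (is_derive_minus (fun _ => I) (RInt f x) y 0 (f y)); [apply (is_derive_const (I : R_NormedModule))|].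
      apply (is_derive_RInt f (RInt f x) x y); [|apply hf].
      apply filter_forall. intros z. apply (RInt_correct f), hex.
    + unfold minus, plus, opp, f; simpl. ring.
  - apply is_lim_spec. intros eps.
    destruct (hI eps (cond_pos eps)) as [M hM].
    (* The hypothesis speaks of any proof of integrability, so one is supplied from the continuity
       of [f]. *)
    exists M. intros b hb. specialize (hM b (Rlt_le _ _ hb) (ex_RInt_Reals_0 _ _ _ (hex x b))).
    rewrite <- RInt_Reals in hM. rewrite Rabs_minus_sym in hM.
    now rewrite Rminus_0_r.
  - rewrite RInt_point. unfold zero; simpl. ring.
Qed.

Lemma ln_sqrt_half (y : R) : 0 < y -> ln (sqrt y) = ln y / 2.
Proof.
  intros hy. pose proof (sqrt_lt_R0 y hy).
  rewrite <- (sqrt_sqrt y) at 2 by lra. rewrite ln_mult by assumption. field.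
Qed.

Theorem theorem7 (n m : nat) (phi : R) (I : R) :
  (1 <= n)%nat -> 0 < phi -> phi < tt n m -> tt n m < 1 ->
  let x := sqrt (INR n / (phi * (1 - phi))) * (tt n m - phi) in
  improper_int_to_infty (fun s => exp (- (s ^ 2) / 2)) x I ->
  let Z := exp (x ^ 2 / 2) * I in
  let t := tt n m in
  let A := - ln (P_X n m phi) in
  let B1 := - ln (P_PBR n m phi) + ln (INR n + 1) - ln (t * sqrt ((1 - phi) / phi))
            - ln (sqrt (INR n) * Z) in
  let B2 := - ln (P_CH n m phi) + / 2 * ln (INR n)
            - ln (sqrt (t * (1 - phi) / (2 * PI * (1 - t) * phi)))
            - ln (sqrt (INR n) * Z) in
  let err := lE n m phi / (INR n * (t - phi)) in
  (B1 - err <= A <= B1) /\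
  (B2 - err <= A <= B2 + / (12 * INR n * t * (1 - t))).
Proof.
  intros hn hphi0 hphit ht1 x hI Z t A B1 B2 err.
  pose proof PI_RGT_0 as hpi.
  pose proof (lt_0_INR n ltac:(lia)) as hn0.
  assert (htn : INR m = INR n * t) by (unfold t, tt; field; lra).
  fold t in hphit, ht1.
  assert (hmn : (1 <= m < n)%nat).
  { split.
    - apply INR_lt. simpl. rewrite htn. apply Rmult_lt_0_compat; lra.
    - apply INR_lt. rewrite htn. nra. }
  assert (hp : 0 < phi < 1) by lra.
  assert (hpm : INR n * phi < INR m) by (rewrite htn; apply Rmult_lt_compat_l; lra).
  set (sd := binom_sd n phi).
  pose proof (binom_sd_pos n phi hn hp) as hsd. fold sd in hsd.
  pose proof (binom_sd_sqr n phi hp) as hsd2. fold sd in hsd2.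
  assert (hpq : 0 < phi * (1 - phi)) by (apply Rmult_lt_0_compat; lra).
  assert (hx : binom_std n phi m = x).
  { unfold x. fold t.
    replace (sqrt (INR n / (phi * (1 - phi)))) with (INR n / sd).
    - unfold binom_std. fold sd. rewrite htn. field; lra.
    - symmetry. apply sqrt_lem_1.
      + apply Rdiv_le_0_compat; lra.
      + apply Rdiv_le_0_compat; lra.
      + transitivity (INR n * INR n / (sd * sd)); [field; lra|]. rewrite hsd2. field. lra. }
  destruct (gauss_tail_of_improper_int x I hI) as [J [hJ hJx]].
  assert (hZ : mills J x = Z) by (unfold mills, Z; now rewrite hJx).
  assert (hx0 : 0 < x).
  { rewrite <- hx. unfold binom_std. apply Rdiv_lt_0_compat; [lra | exact hsd]. }
  assert (hZ0 : 0 < Z) by (rewrite <- hZ; now apply mills_pos).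
  (* All estimates are centred at [- ln V]: [B1] equals it, and [B2] differs from it by the Stirling
     error. *)
  set (V := tail_approx n phi (mills J) m).
  assert (hVe : V = sd * binom_term n phi m * (t / phi) * Z).
  { unfold V, tail_approx. rewrite hx, hZ. fold sd.
    replace (INR m / (INR n * phi)) with (t / phi); [reflexivity | rewrite htn; field; lra]. }
  pose proof (binom_term_pos n m phi hp) as hb.
  assert (htp : 0 < t / phi) by (apply Rdiv_lt_0_compat; lra).
  assert (hsb : 0 < sd * binom_term n phi m) by now apply Rmult_lt_0_compat.
  assert (hsbt : 0 < sd * binom_term n phi m * (t / phi)) by now apply Rmult_lt_0_compat.
  assert (hV0 : 0 < V) by (rewrite hVe; now apply Rmult_lt_0_compat).
  assert (hlow : V <= P_X n m phi) by (apply binom_tail_ge_mills; auto; lia || lra).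
  assert (hup1 : P_X n m phi <= V * exp (mills J 0 / 2 * / sd)) by (apply binom_tail_le_mills_exp; auto; lia || lra).
  assert (hup2 : P_X n m phi <= V * (1 + / (INR m - INR n * phi))) by (apply binom_tail_le_mills_inv; auto; lia || lra).
  assert (hntp : 0 < INR n * (t - phi)) by (apply Rmult_lt_0_compat; lra).
  assert (hA1 : A <= - ln V) by (apply Ropp_le_contravar, ln_le; assumption).
  assert (hA2 : - ln V - mills J 0 / 2 * / sd <= A).
  { apply ln_le in hup1; [|lra]. rewrite ln_mult, ln_exp in hup1 by (assumption || apply exp_pos).
    unfold A. lra. }
  assert (hA3 : - ln V - / (INR n * (t - phi)) <= A).
  { replace (INR m - INR n * phi) with (INR n * (t - phi)) in hup2 by (rewrite htn; ring).
    pose proof (exp_ineq1_le (/ (INR n * (t - phi)))) as he.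
    apply (Rmult_le_compat_l V) in he; [|lra].
    pose proof (Rle_trans _ _ _ hup2 he) as h.
    apply ln_le in h; [|lra]. rewrite ln_mult, ln_exp in h by (assumption || apply exp_pos).
    unfold A. lra. }
  assert (hA4 : - ln V - err <= A).
  { unfold err, lE. fold t.
    (* Divided by [n (t - phi)], the first branch of [lE] becomes [sqrt (PI / 2) / (2 sigma)], which
       dominates [mills J 0 / (2 sigma)]; the second becomes the error in [hA3]. *)
    assert (hS : sqrt (PI * INR n / (8 * phi * (1 - phi))) = sqrt (PI / 2) / 2 * INR n / sd).
    { pose proof (sqrt_pos (PI / 2)). apply sqrt_lem_1.
      - apply Rdiv_le_0_compat; [apply Rmult_le_pos; lra | lra].
      - apply Rdiv_le_0_compat; [apply Rmult_le_pos; lra | lra].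
      - transitivity (sqrt (PI / 2) * sqrt (PI / 2) / 4 * (INR n * INR n) / (sd * sd)); [field; lra|].
        rewrite hsd2, sqrt_sqrt by lra. field. lra. }
    pose proof (mills_zero_le J hJ) as hY0.
    apply Rmin_case.
    - rewrite hS.
      replace ((t - phi) * (sqrt (PI / 2) / 2 * INR n / sd) / (INR n * (t - phi)))
        with (sqrt (PI / 2) / 2 * / sd) by (field; lra).
      assert (mills J 0 / 2 * / sd <= sqrt (PI / 2) / 2 * / sd).
      { apply Rmult_le_compat_r; [left; now apply Rinv_0_lt_compat | lra]. }
      lra.
    - unfold Rdiv. rewrite Rmult_1_l. exact hA3. }
  pose proof (C_pos n m) as hC.
  pose proof (pow_lt phi m hphi0) as hpm0. pose proof (pow_lt (1 - phi) (n - m) ltac:(lra)) as hqm0.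
  pose proof (Rmult_lt_0_compat _ _ hC hpm0) as hCp.
  assert (hnm : INR (n - m) = INR n - INR m) by (apply minus_INR; lia).
  assert (hsdl : ln sd = (ln (INR n) + ln phi + ln (1 - phi)) / 2).
  { unfold sd, binom_sd.
    assert (0 < INR n * phi) by now apply Rmult_lt_0_compat.
    rewrite ln_sqrt_half by (apply Rmult_lt_0_compat; lra).
    rewrite !ln_mult by lra. reflexivity. }
  assert (hVl : ln V = ln sd + (ln (Binomial.C n m) + INR m * ln phi + INR (n - m) * ln (1 - phi))
      + (ln t - ln phi) + ln Z).
  { rewrite hVe, !ln_mult, ln_div by (assumption || lra).
    unfold binom_term. rewrite !ln_mult, !ln_pow by (assumption || lra). reflexivity. }
  assert (hnZ : ln (sqrt (INR n) * Z) = ln (INR n) / 2 + ln Z).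
  { rewrite ln_mult, ln_sqrt_half by (assumption || now apply sqrt_lt_R0). reflexivity. }
  (* [P_PBR / (n + 1)] is the weight at [m], and [sqrt n * t * sqrt ((1 - phi) / phi) = sigma * t /
     phi]. *)
  assert (hB1 : B1 = - ln V).
  { unfold B1, P_PBR. fold t. destruct (Rle_dec phi t) as [_|]; [|lra].
    assert (0 < INR (n + 1)) by (apply lt_0_INR; lia).
    pose proof (Rmult_lt_0_compat _ _ hpm0 hqm0).
    assert (0 < phi ^ m * (1 - phi) ^ (n - m) * INR (n + 1)) by now apply Rmult_lt_0_compat.
    assert (0 < (1 - phi) / phi) by (apply Rdiv_lt_0_compat; lra).
    pose proof (sqrt_lt_R0 _ H2).
    rewrite hnZ, hVl, hsdl, !ln_mult, !ln_pow, ln_sqrt_half, ln_div by (assumption || lra).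
    rewrite plus_INR. simpl. field. }
  (* The weight at [m] is [P_CH] times the same weight with [t] in place of [phi]; Stirling's
     formula estimates the latter. *)
  assert (hB2 : B2 - (ln (Binomial.C n m * t ^ m * (1 - t) ^ (n - m))
           + / 2 * ln (2 * PI * INR n * t * (1 - t))) = - ln V).
  { unfold B2, P_CH. fold t. destruct (Rle_dec phi t) as [_|]; [|lra].
    assert (hr1 : 0 < phi / t) by (apply Rdiv_lt_0_compat; lra).
    assert (hr2 : 0 < (1 - phi) / (1 - t)) by (apply Rdiv_lt_0_compat; lra).
    pose proof (pow_lt _ m hr1). pose proof (pow_lt _ (n - m) hr2).
    assert (ht0 : 0 < t) by lra. assert (ht10 : 0 < 1 - t) by lra.
    pose proof (pow_lt t m ht0). pose proof (pow_lt (1 - t) (n - m) ht10).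
    pose proof (Rmult_lt_0_compat _ _ hC H1).
    assert (0 < 2 * PI) by lra.
    assert (0 < 2 * PI * INR n) by now apply Rmult_lt_0_compat.
    assert (0 < 2 * PI * INR n * t) by now apply Rmult_lt_0_compat.
    assert (0 < 2 * PI * (1 - t)) by now apply Rmult_lt_0_compat.
    assert (0 < 2 * PI * (1 - t) * phi) by now apply Rmult_lt_0_compat.
    assert (0 < t * (1 - phi)) by (apply Rmult_lt_0_compat; lra).
    rewrite hnZ, hVl, hsdl, ln_sqrt_half by now apply Rdiv_lt_0_compat.
    rewrite (ln_div (t * (1 - phi))) by assumption.
    rewrite !ln_mult, !ln_pow, !ln_div by (assumption || lra).
    field. }
  (* The Stirling error is nonpositive, so it costs nothing in the lower bound and at most
     [1 / (12 n t (1 - t))] in the upper one. *)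
  pose proof (binomial_stirling n m hmn) as hst. fold (tt n m) in hst. fold t in hst.
  cbv zeta in hst. rewrite hB1. lra.
Qed.
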